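(* Let $p,q,s$ be complex constants with $p\ne0$ and let $(a_n^k)_{n,k\ge0}$ be complex numbers satisfying $$a_n^k=(pn+q)\,a_n^{k-1}+s\,(n+1)\,a_{n+1}^{k-1}\qquad(n\ge0,\ k\ge1).$$ Then, as formal power series, $$\bar A(t)=\exp(qt)\;a\!\left(\frac{s}{p}\bigl(\exp(pt)-1\bigr)\right).$$
   Context: Superscripts in $a_n^k$ are indices, not powers. The initial sequence $(a_n^0)_{n\ge0}$ is arbitrary. $a(t)=\sum_{n\ge0}a_n^0t^n$ is the ordinary generating function of the initial sequence and $\bar A(t)=\sum_{n\ge0}a_0^n\frac{t^n}{n!}$ is the exponential generating function of the final sequence $(a_0^n)_{n\ge0}$. *)

(* Defs.v *)
(* MathComp with the classical axioms of mathcomp.classical: equality of formal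
   power series is equality of coefficient functions. *)
From HB Require Import structures.
From mathcomp Require Import all_boot all_order all_algebra.
From mathcomp Require Import boolp classical_sets functions reals complex.

Set Implicit Arguments.
Unset Strict Implicit.
Unset Printing Implicit Defensive.

Import GRing.Theory.
Local Open Scope ring_scope.

(* R[[t]]; an alias, so that the pointwise product on nat -> R is not inferred. *)
Definition fps (R : Type) : Type := nat -> R.

Section FpsRing.
Variable R : comNzRingType.
Implicit Types (f g h : fps R) (n : nat) (c : R).

HB.instance Definition _ := GRing.Zmodule.copy (fps R) (nat -> R).

Definition fps_one : fps R := fun n => (n == 0%N)%:R.

Definition fps_mul f g : fps R := fun n => \sum_(i < n.+1) f i * g (n - i)%N.

Definition fps_scale c f : fps R := fun n => c * f n.

Let trunc n f : {poly R} := \poly_(i < n.+1) f i.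

Let truncM n f g m : (m <= n)%N -> fps_mul f g m = (trunc n f * trunc n g)`_m.
Proof.
move=> mn; rewrite coefM; apply: eq_bigr => i _; rewrite !coef_poly !ltnS.
by rewrite (leq_trans (leq_subr _ _) mn) (leq_trans _ mn) // -ltnS.
Qed.

Fact fps_mulA : associative fps_mul.
Proof.
move=> f g h; apply: funext => n.
have E m : (m <= n)%N -> (trunc n (fps_mul f g))`_m = (trunc n f * trunc n g)`_m.
  by move=> mn; rewrite coef_poly ltnS mn (truncM _ _ mn).
have F m : (m <= n)%N -> (trunc n (fps_mul g h))`_m = (trunc n g * trunc n h)`_m.
  by move=> mn; rewrite coef_poly ltnS mn (truncM _ _ mn).
rewrite !(truncM _ _ (leqnn n)) [LHS]coefM [RHS]coefM.
transitivity (trunc n f * (trunc n g * trunc n h))`_n.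
  by rewrite coefM; apply: eq_bigr => i _; rewrite F ?leq_subr.
rewrite mulrA coefM; apply: eq_bigr => i _; rewrite E //.
by rewrite -ltnS.
Qed.

Fact fps_mulC : commutative fps_mul.
Proof.
by move=> f g; apply: funext => n; rewrite !(truncM _ _ (leqnn n)) mulrC.
Qed.

Fact fps_mul1 : left_id fps_one fps_mul.
Proof.
move=> f; apply: funext => n; rewrite /fps_mul big_ord_recl subn0 mul1r.
by rewrite big1 ?addr0 // => i _; rewrite mul0r.
Qed.

Fact fps_mulDl : left_distributive fps_mul +%R.
Proof.
move=> f g h; apply: funext => n; rewrite /fps_mul [RHS]/GRing.add /= -big_split.
by apply: eq_bigr => i _; rewrite /= -mulrDl.
Qed.

Fact fps_one_neq0 : fps_one != 0.
Proof.
apply/eqP => /(congr1 (fun f : fps R => f 0%N)) /eqP.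
by rewrite (oner_eq0 R).
Qed.

HB.instance Definition _ := GRing.Zmodule_isComNzRing.Build (fps R)
  fps_mulA fps_mulC fps_mul1 fps_mulDl fps_one_neq0.

Fact fps_scaleA a b f : fps_scale a (fps_scale b f) = fps_scale (a * b) f.
Proof. by apply: funext => n; rewrite /fps_scale mulrA. Qed.

Fact fps_scale1 : left_id 1 fps_scale.
Proof. by move=> f; apply: funext => n; rewrite /fps_scale mul1r. Qed.

Fact fps_scaleDr : right_distributive fps_scale +%R.
Proof. by move=> c f g; apply: funext => n; exact: mulrDr. Qed.

Fact fps_scaleDl f : {morph fps_scale^~ f : a b / a + b}.
Proof. by move=> a b; apply: funext => n; exact: mulrDl. Qed.

HB.instance Definition _ := GRing.Zmodule_isLmodule.Build R (fps R)
  fps_scaleA fps_scale1 fps_scaleDr fps_scaleDl.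

Definition fpsX : fps R := fun n => (n == 1%N)%:R.

(* f(g(t)) = \sum_k f_k g(t)^k, meaningful only when g has zero constant term:
   then g^k has order at least k, and only the terms k <= n contribute to the
   coefficient of t^n (see fps_compE). *)
Definition fps_comp f g : fps R := fun n => \sum_(k < n.+1) f k * (g ^+ k) n.

Lemma fps_expr_small g k n : g 0%N = 0 -> (n < k)%N -> (g ^+ k) n = 0.
Proof.
move=> g0; elim: k n => [//|k IH] n; rewrite ltnS => nk.
rewrite exprS [LHS]big_ord_recl /= g0 mul0r add0r big1 // => i _.
by rewrite IH ?mulr0 //= (leq_trans _ nk) // ltn_subrL /= (leq_trans _ (ltn_ord i)).
Qed.

Lemma fps_compE f g n m : g 0%N = 0 -> (n < m)%N ->
  fps_comp f g n = \sum_(k < m) f k * (g ^+ k) n.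
Proof.
move=> g0 nm; rewrite /fps_comp (big_ord_widen _ (fun k => f k * (g ^+ k) n) nm).
rewrite [RHS](bigID (fun k : 'I_m => (k < n.+1)%N)) /=.
rewrite [X in _ = _ + X]big1 ?addr0 // => k; rewrite -leqNgt => nk.
by rewrite fps_expr_small ?mulr0.
Qed.

Definition ogf (u : nat -> R) : fps R := u.

End FpsRing.

Arguments fpsX {R}.

Definition egf (F : fieldType) (u : nat -> F) : fps F := fun n => u n / n`!%:R.

Definition fps_exp (F : fieldType) (g : fps F) : fps F := fps_comp (egf (fun=> 1)) g.

Fact fps_exp_subr1_coef0 (F : fieldType) (c d : F) :
  (d *: (fps_exp (c *: fpsX) - 1)) 0%N = 0.
Proof.
have -> : (d *: (fps_exp (c *: fpsX) - 1)) 0%N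
    = d * (fps_exp (c *: fpsX) 0%N - 1) by [].
by rewrite /fps_exp /fps_comp big_ord1 /egf fact0 divr1 mul1r expr0 subrr mulr0.
Qed.

(* Main.v *)
(* The series h_m = exp(qt) phi^m with phi = (s/p)(exp(pt) - 1) satisfy
   h_m' = (p m + q) h_m + s m h_(m-1), because phi' = s + p phi.  This operator
   on (h_m) is the transpose of the recurrence operator on (a_m^k), so
   differentiating \sum_m a_m^k h_m just raises k by one.  As h_m(0) = 0 for
   m > 0, the n-th derivative of exp(qt) a(phi) at 0 is therefore a_0^n. *)
Require Import Defs.
From mathcomp Require Import all_boot all_order all_algebra.
From mathcomp Require Import boolp reals complex.
From mathcomp Require Import ring.

Set Implicit Arguments.
Unset Strict Implicit.
Unset Printing Implicit Defensive.

Import GRing.Theory Num.Theory.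
Local Open Scope ring_scope.

Section FpsCoef.
Variable R : comNzRingType.
Implicit Types (f g h : fps R) (c : R).

Lemma fps_coefD f g n : (f + g) n = f n + g n. Proof. by []. Qed.

Lemma fps_coefM f g n : (f * g) n = \sum_(i < n.+1) f i * g (n - i)%N.
Proof. by []. Qed.

Lemma fps_coefZ c f n : (c *: f) n = c * f n. Proof. by []. Qed.

Lemma fps_scaleAl c f g : c *: (f * g) = (c *: f) * g.
Proof.
apply: funext => n; rewrite fps_coefZ !fps_coefM mulr_sumr.
by apply: eq_bigr => i _; rewrite fps_coefZ mulrA.
Qed.

Lemma fps_scaleAr c f g : c *: (f * g) = f * (c *: g).
Proof. by rewrite mulrC fps_scaleAl mulrC. Qed.

Lemma fps_coefXM f n : (fpsX * f) n.+1 = f n.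
Proof.
rewrite fps_coefM 2!big_ord_recl big1 => [|i _]; last by rewrite /fpsX /= mul0r.
by rewrite /fpsX /= mul0r add0r mul1r addr0 /bump /= subSS subn0.
Qed.

Lemma fps_coefZXn c k n : ((c *: fpsX) ^+ k) n = c ^+ k * (n == k)%:R.
Proof.
elim: k n => [|k IH] n; first by rewrite mul1r.
rewrite exprS -fps_scaleAl fps_coefZ; case: n => [|n].
  by rewrite fps_coefM big_ord1 /fpsX /= mul0r !mulr0.
by rewrite fps_coefXM IH mulrA -exprS.
Qed.

Lemma fps_mul_expr_small f g m n : g 0%N = 0 -> (n < m)%N -> (f * g ^+ m) n = 0.
Proof.
move=> g0 nm; rewrite fps_coefM big1 // => i _.
by rewrite fps_expr_small ?mulr0 // (leq_ltn_trans (leq_subr _ _)).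
Qed.

(** Since [h] has no constant term, all coefficients of the composition up to [n] can be cut off at
    the common bound [n.+1]; the two finite sums then commute. *)
Lemma fps_mul_comp f g h n : h 0%N = 0 ->
  (f * fps_comp g h) n = \sum_(m < n.+1) g m * (f * h ^+ m) n.
Proof.
move=> h0; rewrite fps_coefM.
under eq_bigr => i _.
  rewrite (@fps_compE _ _ _ _ n.+1) ?ltnS ?leq_subr // mulr_sumr; over.
rewrite exchange_big; apply: eq_bigr => m _ /=.
by rewrite fps_coefM mulr_sumr; apply: eq_bigr => i _; rewrite mulrCA.
Qed.

Definition fps_deriv f : fps R := fun n => n.+1%:R * f n.+1.

Lemma fps_derivD f g : fps_deriv (f + g) = fps_deriv f + fps_deriv g.
Proof. by apply: funext => n; exact: mulrDr. Qed.

Lemma fps_derivZ c f : fps_deriv (c *: f) = c *: fps_deriv f.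
Proof. by apply: funext => n; exact: mulrCA. Qed.

Lemma fps_deriv1 : fps_deriv 1 = 0.
Proof. by apply: funext => n; exact: mulr0. Qed.

Lemma fps_derivM f g : fps_deriv (f * g) = fps_deriv f * g + f * fps_deriv g.
Proof.
apply: funext => n; rewrite fps_coefD /fps_deriv !fps_coefM mulr_sumr.
(* The weight [n.+1] is split as [i + (n.+1 - i)], one part for each factor. *)
transitivity (\sum_(i < n.+2) i%:R * f i * g (n.+1 - i)%N
            + \sum_(i < n.+2) f i * ((n.+1 - i)%:R * g (n.+1 - i)%N)).
  rewrite -big_split; apply: eq_bigr => i _ /=.
  by rewrite -{1}(subnKC (leq_ord i)) natrD; ring.
(* The first sum loses its term [i = 0], the second its term [i = n.+1]. *)
congr (_ + _).
  by rewrite big_ord_recl !mul0r add0r; apply: eq_bigr => i _; rewrite /= subSS.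
rewrite big_ord_recr /= subnn mul0r mulr0 addr0; apply: eq_bigr => i _.
by rewrite subSn // leq_ord.
Qed.

Lemma fps_derivX f m : fps_deriv (f ^+ m) = m%:R *: (f ^+ m.-1 * fps_deriv f).
Proof.
elim: m => [|m IH]; first by rewrite fps_deriv1 scale0r.
rewrite exprS fps_derivM IH -fps_scaleAr mulrA -exprS /= mulrC.
(* The exponent [m.-1.+1] is [m] only for positive [m]; at [m = 0] the scalar kills the term. *)
case: m {IH} => [|m]; first by rewrite scale0r addr0 scale1r.
by rewrite /= -[in RHS]natr1 scalerDl scale1r addrC.
Qed.

End FpsCoef.

Section FpsExp.
Variable F : numFieldType.
Implicit Types (c p q s : F).

Lemma fps_expE c n : fps_exp (c *: fpsX) n = c ^+ n / n`!%:R.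
Proof.
rewrite /fps_exp /fps_comp big_ord_recr big1 => [|i _] /=.
  by rewrite add0r fps_coefZXn eqxx mulr1 /egf div1r mulrC.
by rewrite fps_coefZXn gtn_eqF ?mulr0.
Qed.

Lemma fps_deriv_exp c : fps_deriv (fps_exp (c *: fpsX)) = c *: fps_exp (c *: fpsX).
Proof.
apply: funext => n; rewrite fps_coefZ /fps_deriv !fps_expE factS natrM exprS.
by field; rewrite nat1r !pnatr_eq0 -lt0n fact_gt0.
Qed.

(** As [p != 0], the derivative is $s\exp(pt)$, and $s\exp(pt) = s + p\phi$. *)
Lemma fps_deriv_exp_subr1 s p : p != 0 ->
  let phi : fps F := (s / p) *: (fps_exp (p *: fpsX) - 1) in
  fps_deriv phi = s *: (1 : fps F) + p *: phi.
Proof.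
move=> p0 /=; rewrite fps_derivZ -scaleN1r fps_derivD fps_derivZ fps_deriv1.
rewrite scaler0 addr0 fps_deriv_exp !scalerA divfK // mulrCA divff // mulr1.
by rewrite scaleN1r scalerBr addrC subrK.
Qed.

Lemma fps_deriv_exp_mul_expr p q s m : p != 0 ->
  let phi : fps F := (s / p) *: (fps_exp (p *: fpsX) - 1) in
  let h k : fps F := fps_exp (q *: fpsX) * phi ^+ k in
  fps_deriv (h m) = (p * m%:R + q) *: h m + (s * m%:R) *: h m.-1.
Proof.
move=> p0 phi h; rewrite {}/h.
have Dphi : fps_deriv phi = s *: (1 : fps F) + p *: phi.
  exact: fps_deriv_exp_subr1.
rewrite fps_derivM fps_deriv_exp fps_derivX Dphi -fps_scaleAl.
(* At [m = 0] the default [0.-1 = 0] is harmless: its coefficient is [s * 0]. *)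
clearbody phi; case: m => [|m]; first by rewrite !mulr0 !scale0r mulr0 add0r.
rewrite /= [phi ^+ m * _]mulrDr -!fps_scaleAr mulr1 -exprSr mulrDr -!fps_scaleAr.
rewrite scalerDr !scalerA scalerDl [_ * s]mulrC [_ * p]mulrC.
by rewrite addrA addrAC [_ + q *: _]addrC.
Qed.

(* The shift by k makes the induction on n go through. *)
Lemma fps_exp_mul_comp_coef p q s (a : nat -> nat -> F) n k : p != 0 ->
  (forall n k, a n k.+1 = (p * n%:R + q) * a n k + s * n.+1%:R * a n.+1 k) ->
  (fps_exp (q *: fpsX) *
   fps_comp (a^~ k) ((s / p) *: (fps_exp (p *: fpsX) - 1))) n * n`!%:R =
  a 0%N (n + k)%N.
Proof.
move=> p0 ha; rewrite fps_mul_comp ?fps_exp_subr1_coef0 //.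
pose phi : fps F := (s / p) *: (fps_exp (p *: fpsX) - 1).
pose h m : fps F := fps_exp (q *: fpsX) * phi ^+ m.
have hS m i : i.+1%:R * h m i.+1 = (p * m%:R + q) * h m i + s * m%:R * h m.-1 i.
  exact: (congr1 (@^~ i) (fps_deriv_exp_mul_expr q s m p0)).
rewrite -/phi; under eq_bigr => m _ do rewrite -/(h _).
elim: n k => [|n IH] k.
  rewrite big_ord1 mulr1 /h expr0 mulr1 fps_expE expr0.
  by rewrite fact0 divr1 mulr1.
(* The induction hypothesis is used at [k.+1]. The factor [n.+1] split off the factorial turns
   [h m n.+1] into a coefficient of the derivative, to which [hS] applies. *)
rewrite addSnnS -IH factS natrM mulrA; congr (_ * _).
transitivity (\sum_(m < n.+2) ((p * m%:R + q) * a m k * h m n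
                             + s * m%:R * a m k * h m.-1 n)).
  rewrite mulr_suml; apply: eq_bigr => m _.
  by rewrite -mulrA [h _ _ * _]mulrC hS; ring.
(* The series [h n.+1] has order at least [n.+1], so the top term of the first sum drops out. *)
have h0 : h n.+1 n = 0.
  by apply: fps_mul_expr_small => //; exact: fps_exp_subr1_coef0.
rewrite big_split big_ord_recr /= h0 mulr0 addr0.
(* The term [m = 0] of the second sum vanishes. Shifting its index by one pairs both sums on
   [h m n], with the right side of the recurrence as coefficient. *)
rewrite [X in _ + X]big_ord_recl /= mulr0 !mul0r add0r -big_split.
by apply: eq_bigr => m _ /=; rewrite ha [RHS]mulrDl.
Qed.

End FpsExp.

Theorem theorem22 (R : realType) (p q s : R[i]) (a : nat -> nat -> R[i])
  (hp : p != 0)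
  (* a n k is a_n^k *)
  (ha : forall n k : nat, (1 <= k)%N ->
     a n k = (p * n%:R + q) * a n k.-1 + s * n.+1%:R * a n.+1 k.-1) :
  egf (fun n => a 0%N n) =
    fps_exp (q *: fpsX) *
    fps_comp (ogf (fun n => a n 0%N)) ((s / p) *: (fps_exp (p *: fpsX) - 1)).
Proof.
apply: funext => n; apply: (canLR (mulfK _)).
  by rewrite pnatr_eq0 -lt0n fact_gt0.
(* The claim is the case [k = 0] of the shifted coefficient formula. *)
rewrite -[n in LHS]addn0.
by rewrite -(fps_exp_mul_comp_coef n 0 hp (fun n k => ha n k.+1 isT)).
Qed.
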